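(* Let $(a_{n,m}\mid n,m\in\mathbb{N})$ be a double-index sequence of real numbers and let $\ell\in\mathbb{R}\cup\{\pm\infty\}$. If $\lim_{m\to\infty}a_{n,m}\in\mathbb{R}$ exists for every $n$, then the following properties are equivalent to each other: (1) $\lim_{n\to\infty}\left(\lim_{m\to\infty}a_{n,m}\right)=\ell$. (2) $(\mathcal{U}\otimes\mathcal{V})\text{-}\lim_{(n,m)}a_{n,m}=\ell$ for all non-principal ultrafilters $\mathcal{U}$ and $\mathcal{V}$ on $\mathbb{N}$. (3) For every non-principal ultrafilter $\mathcal{U}$ on $\mathbb{N}$ there exists a non-principal ultrafilter $\mathcal{V}$ on $\mathbb{N}$ such that $(\mathcal{U}\otimes\mathcal{V})\text{-}\lim_{(n,m)}a_{n,m}=\ell$.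
   Context: For ultrafilters $\mathcal{U},\mathcal{V}$ on $\mathbb{N}$, the tensor product $\mathcal{U}\otimes\mathcal{V}$ is the ultrafilter on $\mathbb{N}\times\mathbb{N}$ defined by: $X\in\mathcal{U}\otimes\mathcal{V}$ if and only if $\{n\in\mathbb{N}\mid\{m\in\mathbb{N}\mid (n,m)\in X\}\in\mathcal{V}\}\in\mathcal{U}$. For an ultrafilter $\mathcal{W}$ on a set $I$, a real sequence $(a_i\mid i\in I)$ and $\ell\in\mathbb{R}$, one writes $\mathcal{W}\text{-}\lim_i a_i=\ell$ if $\{i\in I\mid a_i\in U\}\in\mathcal{W}$ for every neighborhood $U$ of $\ell$; one writes $\mathcal{W}\text{-}\lim_i a_i=+\infty$ if $\{i\in I\mid a_i>k\}\in\mathcal{W}$ for every $k\in\mathbb{N}$, and $\mathcal{W}\text{-}\lim_i a_i=-\infty$ if $\{i\in I\mid a_i<-k\}\in\mathcal{W}$ for every $k\in\mathbb{N}$. *)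

(* Defs.v *)
From mathcomp Require Import all_boot all_order all_algebra.
From mathcomp Require Import all_classical all_reals all_analysis.
Set Implicit Arguments.
Unset Strict Implicit.
Unset Printing Implicit Defensive.
Import Order.TTheory GRing.Theory Num.Theory.
Import numFieldNormedType.Exports.
Local Open Scope classical_set_scope.
Local Open Scope ring_scope.

Definition nonprincipal (T : Type) (U : set_system T) : Prop :=
  forall x : T, U <> principal_filter x.

(* Not the product filter of the library: tensor_filter U V is not symmetric
   and in general strictly contains filter_prod U V. *)
Definition tensor_filter (S T : Type) (U : set_system S) (V : set_system T) :
    set_system (S * T) :=
  [set X | U [set n | V [set m | X (n, m)]]].

Lemma tensor_filter_ultra (S T : Type) (U : set_system S) (V : set_system T) :
  UltraFilter U -> UltraFilter V -> UltraFilter (tensor_filter U V).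
Proof.
move=> uU uV.
have fT : Filter (tensor_filter U V).
  split.
  - by apply: (@filterE _ U) => n; exact: (@filterT _ V).
  - move=> P Q UP UQ; apply: (@filterS _ U) (@filterI _ U _ _ _ UP UQ) => n [VP VQ].
    exact: (@filterI _ V).
  - move=> P Q PQ; apply: (@filterS _ U) => n; apply: (@filterS _ V) => m.
    exact: PQ.
split.
  apply: Build_ProperFilter_ex.
  move=> A UA.
  have [n VA] := @filter_ex _ U _ _ UA.
  have [m Anm] := @filter_ex _ V _ _ VA.
  by exists (n, m).
move=> G GG sUG; rewrite eqEsubset; split=> // A GA; apply: contrapT => nA.
have [//|UnA] := in_ultra_setVsetC [set n | V [set m | A (n, m)]] uU.
apply: (@filter_not_empty _ G); rewrite -(setICr A).
apply: filterI => //; apply: sUG; apply: (@filterS _ U) UnA => n nVA.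
by have [//|] := in_ultra_setVsetC [set m | A (n, m)] uV.
Qed.

Section ultralimit.
Context {R : realType} {I : Type}.

Definition is_ultralim (W : set_system I) (a : I -> R) (l : \bar R) : Prop :=
  match l with
  | r%:E => a @ W --> r
  | +oo%E => forall k : nat, W [set i | k%:R < a i]
  | -oo%E => forall k : nat, W [set i | a i < - k%:R]
  end.

Lemma is_ultralimE (W : set_system I) (a : I -> R) (l : \bar R) :
  UltraFilter W -> is_ultralim W a l <-> (a i)%:E @[i --> W] --> l.
Proof.
move=> uW; have fW : Filter W by exact: filter_filter.
case: l => [r| |] /=.
- split=> [h|]; first by apply: (cvg_comp _ EFin h).
  by move=> /fine_cvgP[].
- split=> [h|/cvgeyPgt h k].
    apply/cvgeyPgt => A; apply: filterS (h (Num.truncn `|A|).+1) => i /=.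
    rewrite lte_fin; apply: lt_trans; apply: le_lt_trans (ler_norm A) _.
    exact: truncnS_gt.
  by apply: filterS (h k%:R) => i /=; rewrite lte_fin.
- split=> [h|/cvgeNyPlt h k].
    apply/cvgeNyPlt => A; apply: filterS (h (Num.truncn `|A|).+1) => i /=.
    rewrite lte_fin => /lt_trans; apply; rewrite ltrNl.
    by apply: le_lt_trans (truncnS_gt `|A|); rewrite -normrN ler_norm.
  by apply: filterS (h (- k%:R)) => i /=; rewrite lte_fin.
Qed.

End ultralimit.

(* Main.v *)
Require Import Defs.
From mathcomp Require Import all_boot all_order all_algebra.
From mathcomp Require Import all_classical all_reals all_analysis.
Import Order.TTheory GRing.Theory Num.Theory.
Import numFieldNormedType.Exports.
Local Open Scope classical_set_scope.
Local Open Scope ring_scope.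

(** Two general facts reduce the theorem to a statement about one sequence.

    - [cvg_tensor_filter]: in a regular space, such as [\bar R], a limit along
      [tensor_filter U V] can be computed iteratively. If each row [f s] has
      limit [g s] along [V], then [f] tends to [l] along the tensor product
      exactly when [g] tends to [l] along [U]; [V] matters only through the row
      limits.
    - [cvg_ultraP]: a filter is the intersection of the ultrafilters finer than
      it, so convergence along it amounts to convergence along each of them.

    On the natural numbers, the ultrafilters finer than [\oo] are exactly the
    nonprincipal ones ([nonprincipal_ultra_natP]). The rows of [a] therefore
    have the same limits along every nonprincipal [V] as along [\oo], and all
    three properties say that the sequence of row limits tends to [l] along
    every nonprincipal ultrafilter. The existential in the last property is
    witnessed by any nonprincipal [V], for instance [U] itself. *)

(** If [F] does not contain [A] then [F] together with the complement of [A]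
    still generates a proper filter, and any ultrafilter finer than that one
    misses [A]. *)
Lemma filter_ultraP (T : Type) (F : set_system T) (A : set T) : Filter F ->
  F A <-> forall G : set_system T, UltraFilter G -> F `<=` G -> G A.
Proof.
move=> FF; split=> [FA G _|GA]; first exact.
apply: contrapT => nFA.
have wP : ProperFilter (within (~` A) F).
  split; last exact: within_filter.
  by rewrite /within /= => FA; apply: nFA; apply: filterS FA => x /contrapT.
have [G [uG sG]] := ultraFilterLemma wP.
have GAC : G (~` A) by apply: sG; exact: withinT.
apply: (@filter_not_empty _ G); rewrite -(setICr A); apply: filterI => //.
by apply: GA => B FB; apply: sG; apply: filterS FB => x Bx _.
Qed.

Lemma cvg_ultraP (T : Type) (X : topologicalType) (F : set_system T)
    (u : T -> X) (l : X) : Filter F ->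
  u @ F --> l <->
  forall G : set_system T, UltraFilter G -> F `<=` G -> u @ G --> l.
Proof.
move=> FF; split=> [ul G _ FG A /ul|ul A lA]; first exact: FG.
by apply/(@filter_ultraP _ F) => G uG FG; exact: ul lA.
Qed.

(** An ultrafilter containing a singleton is principal, by maximality of the
    principal filter. So a nonprincipal one contains the complement of every
    point, hence of every initial segment, i.e. it contains every tail. *)
Lemma nonprincipal_ultra_natP (U : set_system nat) : UltraFilter U ->
  nonprincipal U <-> \oo `<=` U.
Proof.
move=> uU; split=> [npU A|ooU x Ux]; last first.
  have /ooU : \oo [set n | (x < n)%N] by exact: nbhs_infty_gt.
  by rewrite Ux => /principal_filterP; rewrite /= ltnn.
have UC x : U (~` [set x]).
  have [Ux|//] := in_ultra_setVsetC [set x] uU.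
  case: (npU x); apply: (@max_filter _ _ (principal_filter_ultra x)).
  by move=> B Bx; apply: filterS Ux => y ->; exact/principal_filterP.
move=> [N _ NA]; apply: filterS NA _ => /=.
elim: N => [|N IHN]; first exact: filterE.
by apply: filterS2 IHN (UC N) => n /= Nn /eqP nN; rewrite ltn_neqAle eq_sym nN.
Qed.

(** If the rows converge, the set of [s] whose row is eventually in an open
    neighbourhood of [l] contains every [s] with [g s] in that neighbourhood.
    Conversely a row that is eventually in [B] only has its limit in the
    closure of [B], which is why [X] has to be regular: [l] has arbitrarily
    small closed neighbourhoods. *)
Lemma cvg_tensor_filter (S T : Type) (X : topologicalType)
    (U : set_system S) (V : set_system T) (f : S -> T -> X) (g : S -> X)
    (l : X) : Filter U -> ProperFilter V -> regular_space X ->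
  (forall s, f s @ V --> g s) ->
  (f p.1 p.2 @[p --> tensor_filter U V] --> l) <-> g @ U --> l.
Proof.
move=> FU PV regX fg; split=> [fl A /regX[B lB BA]|gl A].
  have UB : U [set s | V [set t | B (f s t)]] by exact: fl lB.
  suff : U [set s | A (g s)] by [].
  apply: filterS UB => s VB; apply: BA => C /(fg s) VC.
  exact: filter_ex (filterI VB VC).
rewrite nbhsE => -[B [oB Bl] BA].
have UB : U [set s | B (g s)] by apply: gl; exact: open_nbhs_nbhs.
suff : U [set s | V [set t | A (f s t)]] by [].
apply: filterS UB => s Bgs.
have VB : V [set t | B (f s t)] by apply: fg; exact: open_nbhs_nbhs.
by apply: filterS VB => t /BA.
Qed.

Theorem theorem3p4 (R : realType) (a : nat -> nat -> R) (l : \bar R)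
    (a_cvg : forall n : nat, cvg (a n m @[m --> \oo])) :
  [<-> (lim (a n m @[m --> \oo]))%:E @[n --> \oo] --> l;
       forall U V : set_system nat,
         UltraFilter U -> nonprincipal U ->
         UltraFilter V -> nonprincipal V ->
         is_ultralim (tensor_filter U V) (fun p : nat * nat => a p.1 p.2) l;
       forall U : set_system nat,
         UltraFilter U -> nonprincipal U ->
         exists V : set_system nat,
           [/\ UltraFilter V, nonprincipal V &
             is_ultralim (tensor_filter U V)
               (fun p : nat * nat => a p.1 p.2) l] ].
Proof.
have iter U V : UltraFilter U -> UltraFilter V -> nonprincipal V ->
    is_ultralim (tensor_filter U V) (fun p : nat * nat => a p.1 p.2) l <->
    (lim (a n m @[m --> \oo]))%:E @[n --> U] --> l.
  move=> uU uV /nonprincipal_ultra_natP ooV.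
  have uUV := tensor_filter_ultra uU uV.
  apply: iff_trans (is_ultralimE _ _ uUV) _.
  apply: (@cvg_tensor_filter _ _ _ U V (fun n m => (a n m)%:E)).
    exact: uniform_regular.
  by move=> n; apply: (cvg_comp _ EFin) => // A /(a_cvg n); exact: ooV.
tfae.
- move=> /cvg_ultraP al U V uU npU uV npV; apply/iter => //.
  by apply: al => //; exact/nonprincipal_ultra_natP.
- by move=> al U uU npU; exists U; split=> //; exact: al.
- move=> al; apply/cvg_ultraP => U uU /nonprincipal_ultra_natP npU.
  by have [V [uV npV /iter]] := al U uU npU; apply.
Qed.
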